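(* Let $A\subset\mathbb{R}^{1+n}$ be a pseudo-homogeneous support set of cardinality $N$ with elements $\alpha_1,\dots,\alpha_N$, let $f(\mathbf{z})=\sum_{i=1}^N c_i e^{\langle\alpha_i,\mathbf{z}\rangle}\in\mathbb{C}^A$, and let $\kappa_1,\dots,\kappa_N\in\mathbb{R}^k$ be arbitrary vectors (some possibly zero). For $\lambda\in\mathbb{R}$ let $$f_\lambda(\mathbf{z},\mathbf{t})=\sum_{i=1}^N c_i\,e^{\langle\alpha_i,\mathbf{z}\rangle+\lambda\langle\kappa_i,\mathbf{t}\rangle},\qquad \mathbf{z}\in\mathbb{C}^{1+n},\ \mathbf{t}\in\mathbb{C}^k,$$ and let $B$ be the $(1+n+k)\times N$ matrix whose $i$-th column is $\begin{bmatrix}\alpha_i\\ \kappa_i\end{bmatrix}$. Then $$\lim_{\lambda\to0}\mathcal{A}(f_\lambda)=\mathcal{A}_B(f)\times\mathbb{R}^k.$$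
   Context: Pseudo-homogeneous means that there is a linear form $\xi$ with $\langle\xi,\alpha\rangle=1$ for all $\alpha\in A$. $\mathbb{C}^A$ is the space of exponential sums with support in $A$ and complex coefficients. The amoeba of an exponential sum $h$ in $d$ complex variables is $\mathcal{A}(h)=\overline{\operatorname{Re}(V(h))}\subset\mathbb{R}^d$, where $V(h)\subset\mathbb{C}^d$ is its zero set, $\operatorname{Re}$ is taken coordinatewise, and the closure is in the standard topology. Thus $\mathcal{A}(f_\lambda)\subset\mathbb{R}^{1+n}\times\mathbb{R}^k$. The limit $\lim_{\lambda\to0}\mathcal{A}(f_\lambda)$ is by definition the closure of the set of all limit points of sequences $(\mathbf{x}_j,\mathbf{t}_j)\in\mathcal{A}(f_{\lambda_j})$, where $\lambda_j\to0$ as $j\to\infty$ and $\lambda_j\ne0$ for all $j$. Here $A=TB$ with $T=(I,0)$ in block form. The small $B$-caisson $\mathcal{A}_B(f)$ is in this situation the following set: let $g(\mathbf{z},\mathbf{t})=\sum_{i=1}^N c_i e^{\langle\alpha_i,\mathbf{z}\rangle+\langle\kappa_i,\mathbf{t}\rangle}$ be the exponential sum with support $B$ and the same coefficients as $f$, and let $H_T=\{\mathbf{x}T:\mathbf{x}\in\mathbb{R}^{1+n}\}=\mathbb{R}^{1+n}\times\{0\}$; then $\mathcal{A}_B(f)=\mathcal{A}(g)\cap H_T$, considered as a subset of $\mathbb{R}^{1+n}$, i.e. $\mathcal{A}_B(f)=\{\mathbf{x}\in\mathbb{R}^{1+n}:(\mathbf{x},0)\in\mathcal{A}(g)\}$.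 *)

(* Defs.v *)
From HB Require Import structures.
From mathcomp Require Import all_boot all_order all_algebra.
From mathcomp Require Import complex.
From mathcomp Require Import all_classical all_reals all_analysis.
Set Implicit Arguments.
Unset Strict Implicit.
Unset Printing Implicit Defensive.
Import Order.TTheory GRing.Theory Num.Theory.
Import numFieldNormedType.Exports.
Local Open Scope classical_set_scope.
Local Open Scope ring_scope.
Local Open Scope complex_scope.

Section ExponentialSums.
Variable R : realType.

(* e^(a + ib) = e^a (cos b + i sin b) *)
Definition cexp (z : R[i]) : R[i] :=
  (expR (complex.Re z))%:C * (cos (complex.Im z) +i* sin (complex.Im z)).

(* Points are row vectors and exponents are column vectors, the columns of the
   support matrix. The pairing is bilinear, not sesquilinear. *)
Definition pairing d (a : 'cV[R]_d) (z : 'rV[R[i]]_d) : R[i] :=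
  \sum_(j < d) (a j 0)%:C * z 0 j.

Definition pseudo_homogeneous d N (alpha : 'I_N -> 'cV[R]_d) : Prop :=
  exists xi : 'rV[R]_d, forall i, \sum_(j < d) xi 0 j * alpha i j 0 = 1.

Definition exp_sum d N (A : 'M[R]_(d, N)) (c : 'I_N -> R[i])
    (z : 'rV[R[i]]_d) : R[i] :=
  \sum_(i < N) c i * cexp (pairing (col i A) z).

Definition zero_set d (h : 'rV[R[i]]_d -> R[i]) : set 'rV[R[i]]_d :=
  [set z | h z = 0].

Definition amoeba d (h : 'rV[R[i]]_d -> R[i]) : set 'rV[R]_d :=
  closure [set map_mx (@complex.Re R) z | z in zero_set h].

(* R^m x R^k is represented by 'rV_(m + k), the pair (z, t) being row_mx z t. *)
Definition deformation m k N (alpha : 'I_N -> 'cV[R]_m)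
    (kappa : 'I_N -> 'cV[R]_k) (c : 'I_N -> R[i]) (lambda : R)
    (w : 'rV[R[i]]_(m + k)) : R[i] :=
  \sum_(i < N) c i *
    cexp (pairing (alpha i) (lsubmx w)
          + lambda%:C * pairing (kappa i) (rsubmx w)).

Definition lifted_support m k N (alpha : 'I_N -> 'cV[R]_m)
    (kappa : 'I_N -> 'cV[R]_k) : 'M[R]_(m + k, N) :=
  \matrix_(j < m + k, i < N) col_mx (alpha i) (kappa i) j 0.

(* The small B-caisson of the exponential sum with coefficients c, for a matrix
   B with m + k rows and T = (I, 0): here x T = (x, 0). *)
Definition small_caisson m k N (B : 'M[R]_(m + k, N)) (c : 'I_N -> R[i]) :
    set 'rV[R]_m :=
  [set x | amoeba (exp_sum B c) (row_mx x 0)].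

(* Limit points of a sequence are its cluster points. As a subsequence of an
   admissible (l, u) is admissible, restricting to limits of convergent
   sequences u would give the same set when T is first countable. *)
Definition limit_at0 (T : topologicalType) (F : R -> set T) : set T :=
  closure [set p | exists (l : nat -> R) (u : nat -> T),
    [/\ l @ \oo --> (0 : R), forall j, l j != 0, forall j, F (l j) (u j)
      & cluster (u @ \oo) p]].

End ExponentialSums.

(* Main.v *)
(** If [lambda <> 0] then [f_lambda (z, t) = g (z, lambda t)], where [g] has
    support [B]. That the limit is contained in the caisson times [R^k] follows
    because the amoeba of [g] is closed. Conversely, let [(x, 0)] lie in the
    amoeba of [g], and let [(z_j, s_j)] be zeros of [g] whose real parts tend to
    [(x, 0)]. The numbers [c_i e^(<alpha_i, z_j> + <kappa_i, s_j>)] stay bounded,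
    so along a subsequence they converge to some [C_i] with [sum_i C_i = 0].
    Choose [v] such that the exponents [a_i = <alpha_i, v>] are distinct. Then
    [sum_i C_i e^(a_i w)] has an isolated zero at [w = 0], which by a Hurwitz
    argument persists under small changes of the [C_i]; in particular it persists
    when [s_j] is replaced by [i Im s_j + lambda t] with [lambda] small. This gives
    zeros of [g] with real part near [(x, lambda t)], hence zeros of [f_lambda]
    with real part near [(x, t)].

    The Hurwitz argument rests on a minimum modulus principle, which is first
    obtained for polynomials and passes to exponential sums because
    [(1 + z / n)^n] tends to [e^z] uniformly on discs. *)

Require Import Defs.
From HB Require Import structures.
From mathcomp Require Import all_boot all_order all_algebra.
From mathcomp Require Import complex.
From mathcomp Require Import all_classical all_reals all_analysis.
From mathcomp Require Import ring lra.
Set Implicit Arguments.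
Unset Strict Implicit.
Unset Printing Implicit Defensive.
Import Order.TTheory GRing.Theory Num.Theory.
Import numFieldNormedType.Exports.
Local Open Scope classical_set_scope.
Local Open Scope ring_scope.
Local Open Scope complex_scope.

Import ComplexField.Normc.

(** * The modulus of complex numbers *)

Section Modulus.
Variable R : realType.
Implicit Types (w z : R[i]) (x y : R).

(** The summand 1 keeps the bound strictly positive even for an empty sum, so that one may divide by
    it. *)
Lemma ler1D_sum (I : finType) (F : I -> R) i :
  (forall j, 0 <= F j) -> F i <= 1 + \sum_j F j.
Proof.
by move=> F0; rewrite (bigD1 i) //= addrCA lerDl addr_ge0 // sumr_ge0.
Qed.

Lemma normc_ge0 z : 0 <= normc z.
Proof. by case: z => a b; exact: sqrtr_ge0. Qed.

Lemma normc_eq0 z : (normc z == 0) = (z == 0).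
Proof.
by apply/eqP/eqP => [/eq0_normc //|->]; rewrite normc0.
Qed.

Lemma normc_gt0 z : (0 < normc z) = (z != 0).
Proof. by rewrite lt_def normc_ge0 normc_eq0 andbT. Qed.

Lemma normc_real x : normc x%:C = `|x|.
Proof. by rewrite /= expr0n addr0 sqrtr_sqr. Qed.

Lemma normcX z n : normc (z ^+ n) = normc z ^+ n.
Proof. by elim: n => [|n IH]; rewrite ?expr0 ?normc1 // !exprS normcM IH. Qed.

Lemma ler_normcD w z : normc (w + z) <= normc w + normc z.
Proof. exact: (@le_normcD R). Qed.

Lemma normc_opp z : normc (- z) = normc z.
Proof. exact: (@normcN R). Qed.

Lemma ler_normcB w z : normc (w - z) <= normc w + normc z.
Proof. by rewrite -(normc_opp z); exact: ler_normcD. Qed.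

Lemma ler_normc_sum (I : Type) (s : seq I) (P : pred I) (F : I -> R[i]) :
  normc (\sum_(i <- s | P i) F i) <= \sum_(i <- s | P i) normc (F i).
Proof.
elim/big_rec2: _ => [|i x z _ IH]; first by rewrite normc0.
by apply: le_trans (ler_normcD _ _) _; rewrite lerD2l.
Qed.

Lemma normc_prod (I : Type) (s : seq I) (P : pred I) (F : I -> R[i]) :
  normc (\prod_(i <- s | P i) F i) = \prod_(i <- s | P i) normc (F i).
Proof. exact: (big_morph _ (@normcM R) (@normc1 R)). Qed.

Lemma normc_ge_absRe z : `|complex.Re z| <= normc z.
Proof.
by case: z => a b /=; rewrite -sqrtr_sqr ler_wsqrtr // lerDl sqr_ge0.
Qed.

Lemma normc_ge_absIm z : `|complex.Im z| <= normc z.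
Proof.
by case: z => a b /=; rewrite -sqrtr_sqr ler_wsqrtr // lerDr sqr_ge0.
Qed.

Lemma normc_le_ReIm z : normc z <= `|complex.Re z| + `|complex.Im z|.
Proof.
case: z => a b /=.
rewrite -[leRHS]ger0_norm ?addr_ge0 // -sqrtr_sqr ler_wsqrtr //.
rewrite sqrrD !real_normK ?num_real // lerD2r lerDl.
by rewrite mulrn_wge0 // mulr_ge0.
Qed.

(* Averaging over the roots of [X^M = 1]: each zero [z] with [r <= |z|]
   contributes [|z^M - r^M| <= 2 |z|^M] to [\prod_om p (r om)], so that
   [m^M <= 2^(deg p) |p 0|^M] for every [M]. *)
Lemma minimum_modulus_poly (p : {poly R[i]}) (r m : R) : 0 < r ->
    (forall w, normc w < r -> p.[w] != 0) ->
    (forall w, normc w = r -> m <= normc p.[w]) ->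
  m <= normc p.[0].
Proof.
move=> r0 pN0 pm; rewrite leNgt; apply/negP => p0m.
have p0_gt0 : 0 < normc p.[0] by rewrite normc_gt0 pN0 ?normc0.
have m0 : 0 < m by exact: lt_trans p0m.
have [s] := closed_field_poly_normal p; set l := lead_coef p => ps.
have pE w : normc p.[w] = normc l * \prod_(z <- s) normc (w - z).
  rewrite ps hornerZ normcM horner_prod normc_prod.
  by under eq_bigr do rewrite hornerXsubC.
have s_ge z : z \in s -> r <= normc z.
  move=> zs; rewrite leNgt; apply/negP => /pN0; rewrite -normc_eq0 pE => /negP.
  by apply; rewrite (big_rem z) //= subrr normc0 mul0r mulr0.
(* The ratio is below 1 by the assumption to be refuted, so a large power beats the factor 2 lost at
   each zero. *)
have [M yM] : exists M, (normc p.[0] / m) ^+ M < (2 ^+ size s)^-1.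
  have /cvgrPdist_lt/(_ ((2 ^+ size s)^-1)) :
      (fun n => (normc p.[0] / m) ^+ n) @ \oo --> 0.
    apply: cvg_expr; rewrite ger0_norm ?divr_ge0 ?(ltW m0) ?normc_ge0 //.
    by rewrite ltr_pdivrMr ?mul1r.
  rewrite invr_gt0 exprn_gt0 // => /(_ isT)[M _ /(_ M (leqnn M))] /=.
  by rewrite sub0r normrN => h; exists M; exact: le_lt_trans (ler_norm _) h.
have M0 : (0 < M)%N.
  case: M yM => //; rewrite expr0 ltNge => /negP[].
  by rewrite invf_le1 ?exprn_gt0 // exprn_ege1 // (ler_nat R 1 2).
have [t] := closed_field_poly_normal ('X^M - 1 : {poly R[i]}).
rewrite -polyC1 (eqP (monicXnsubC _ M0)) scale1r polyC1 => tE.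
have size_t : size t = M.
  by apply: succn_inj; rewrite -(size_prod_XsubC t id) -tE size_XnsubC.
have t1 om : om \in t -> normc om = 1.
  move=> omt; have : ('X^M - 1 : {poly R[i]}).[om] = 0.
    by rewrite tE; apply/rootP; rewrite root_prod_XsubC.
  rewrite hornerD hornerN hornerXn hornerC => /subr0_eq omM.
  apply: (@pexpIrn _ M); rewrite ?nnegrE ?normc_ge0 ?ler01 //.
  by rewrite -normcX omM normc1 expr1n.
(* Evaluate the factorisation of [X^M - 1] at [z / r] and scale by [r^M]; the sign disappears in the
   modulus. *)
have prodt z : \prod_(om <- t) normc (r%:C * om - z) = normc (z ^+ M - r%:C ^+ M).
  have rN0 : r%:C != 0 :> R[i] by rewrite -normc_gt0 normc_real gtr0_norm.
  have -> : z ^+ M - r%:C ^+ M = r%:C ^+ M * \prod_(om <- t) (z / r%:C - om).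
    under eq_bigr do rewrite -hornerXsubC.
    rewrite -horner_prod -tE hornerD hornerN hornerXn hornerC.
    by rewrite mulrBr mulr1 -exprMn mulrCA divff // mulr1.
  rewrite -size_t -[in LHS]normc_prod.
  rewrite (eq_bigr (fun om => - r%:C * (z / r%:C - om))); last first.
    by move=> om _; rewrite mulrBr mulNr mulrCA divff // mulr1 mulNr opprK addrC.
  rewrite big_split /= big_const_seq count_predT iter_mulr_1 !normcM !normcX.
  by rewrite normc_opp.
have: m ^+ M <= 2 ^+ size s * normc p.[0] ^+ M.
  have -> : m ^+ M = \prod_(om <- t) m.
    by rewrite big_const_seq count_predT iter_mulr_1 size_t.
  apply: (@le_trans _ _ (\prod_(om <- t) normc p.[r%:C * om])).
    rewrite [leLHS]big_seq [leRHS]big_seq; apply: ler_prod => om /t1 om1.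
    by rewrite (ltW m0) pm // normcM om1 mulr1 normc_real gtr0_norm.
  under eq_bigr do rewrite pE.
  rewrite big_split /= big_const_seq count_predT iter_mulr_1 size_t exchange_big /=.
  under eq_bigr do rewrite prodt.
  rewrite pE exprMn mulrCA ler_wpM2l ?exprn_ge0 ?normc_ge0 //.
  under [in leRHS]eq_bigr do rewrite sub0r normc_opp.
  rewrite -prodrXl.
  have -> : 2 ^+ size s = \prod_(z <- s) 2 :> R.
    by rewrite big_const_seq count_predT iter_mulr_1.
  rewrite -big_split /= [leLHS]big_seq [leRHS]big_seq.
  apply: ler_prod => z /s_ge zr; rewrite normc_ge0 /= mulr_natl mulr2n.
  apply: le_trans (ler_normcB _ _) _; rewrite !normcX lerD2l normc_real gtr0_norm //.
  by rewrite lerXn2r ?nnegrE ?normc_ge0 ?(ltW r0).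
rewrite -ler_pdivrMl ?exprn_gt0 // leNgt => /negP; apply.
by rewrite -ltr_pdivrMr ?exprn_gt0 // -expr_div_n.
Qed.

End Modulus.

#[local] Arguments normc {R} : simpl never.
#[local] Arguments cexp {R} : simpl never.

(** * Exponential sums in one variable *)

Section Cexp.
Variable R : realType.
Implicit Types (w z : R[i]) (x y : R).

Lemma cexpD z w : cexp (z + w) = cexp z * cexp w.
Proof.
case: z w => [a b] [c d]; rewrite /cexp /= expRD cosD sinD.
by apply/eqP; rewrite eq_complex /=; apply/andP; split; apply/eqP; ring.
Qed.

Lemma cexp0 : cexp 0 = 1 :> R[i].
Proof.
rewrite /cexp /= expR0 cos0 sin0.
by apply/eqP; rewrite eq_complex /=; apply/andP; split; apply/eqP; ring.
Qed.

Lemma normc_cexp z : normc (cexp z) = expR (complex.Re z).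
Proof.
rewrite /cexp normcM normc_real ger0_norm ?expR_ge0 // /normc /= cos2Dsin2.
by rewrite sqrtr1 mulr1.
Qed.

Lemma cexpMn z n : cexp (z *+ n) = cexp z ^+ n.
Proof. by elim: n => [|n IH]; rewrite ?mulr0n ?cexp0 // mulrS cexpD IH exprS. Qed.

Lemma cexp_near0 eps : 0 < eps ->
  exists2 rho : R, 0 < rho & forall w, normc w <= rho -> normc (cexp w - 1) <= eps.
Proof.
(* Real and imaginary parts will each cost [2 e]; the 1 in the minimum keeps [|sin y|] below 1. *)
move=> eps0; pose e := Num.min 1 eps / 4.
have e0 : 0 < e by rewrite divr_gt0 // lt_min ltr01.
have /cvgrPdist_lt/(_ _ e0)/nbhs_ballP[d1 /= d10 h1] := @continuous_expR R 0.
have /cvgrPdist_lt/(_ _ e0)/nbhs_ballP[d2 /= d20 h2] := @continuous_cos R 0.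
have /cvgrPdist_lt/(_ _ e0)/nbhs_ballP[d3 /= d30 h3] := @continuous_sin R 0.
pose d := Num.min d1 (Num.min d2 d3); have d0 : 0 < d by rewrite !lt_min d10 d20.
exists (d / 2); first by rewrite divr_gt0.
move=> w wd; have wd' : normc w < d by apply: le_lt_trans wd _; lra.
have [wd1 wd2 wd3] : [/\ normc w < d1, normc w < d2 & normc w < d3].
  by move: wd'; rewrite !lt_min => /and3P[].
have := h1 (complex.Re w); rewrite /ball /= sub0r normrN expR0.
move=> /(_ (le_lt_trans (normc_ge_absRe _) wd1)) {}h1.
have := h2 (complex.Im w); rewrite /ball /= sub0r normrN cos0.
move=> /(_ (le_lt_trans (normc_ge_absIm _) wd2)) {}h2.
have := h3 (complex.Im w); rewrite /ball /= sub0r normrN sin0 sub0r normrN.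
move=> /(_ (le_lt_trans (normc_ge_absIm _) wd3)) {}h3.
have e1 : e <= 1 / 4 by rewrite ler_pM2r ?invr_gt0 // ge_min lexx.
have e2 : e <= eps / 4 by rewrite ler_pM2r ?invr_gt0 // ge_min lexx orbT.
apply: le_trans (normc_le_ReIm _) _.
move: w {wd wd' wd1 wd2 wd3} h1 h2 h3 => [x y]; rewrite /cexp /= => h1 h2 h3.
rewrite !mul0r addr0 subr0 oppr0 addr0.
have ex : `|expR x * cos y - 1| <= e + e.
  have -> : expR x * cos y - 1 = - ((1 - expR x) * cos y) - (1 - cos y) by ring.
  apply: le_trans (ler_normB _ _) _; rewrite normrN normrM lerD ?(ltW h2) //.
  by rewrite -[leRHS]mulr1 ler_pM // ?cos_max // (ltW h1).
have ey : `|expR x * sin y| <= e + e.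
  have -> : expR x * sin y = sin y - (1 - expR x) * sin y by ring.
  apply: le_trans (ler_normB _ _) _; rewrite normrM lerD ?(ltW h3) //.
  rewrite -[leRHS]mulr1 ler_pM // ?(ltW h1) //.
  by apply: le_trans (ltW h3) _; lra.
by apply: le_trans (lerD ex ey) _; lra.
Qed.

(** The restriction of an exponential sum to a complex line [z + w v] with [v] real: [a i] is
    [<alpha_i, v>] and [C i] is the [i]-th term at [z]. *)
Definition exp_sum1 N (a : 'I_N -> R) (C : 'I_N -> R[i]) w : R[i] :=
  \sum_(i < N) C i * cexp ((a i)%:C * w).

(** * Derivatives of complex-valued functions of a real variable *)

Definition path_derive (f : R -> R[i]) (s : R) (df : R[i]) : Prop :=
  is_derive s 1 (fun x => complex.Re (f x)) (complex.Re df) /\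
  is_derive s 1 (fun x => complex.Im (f x)) (complex.Im df).

(** The real mean value theorem is applied to real and imaginary parts separately, at possibly
    different points; hence the bound [B] twice. *)
Lemma path_mean_value (f df : R -> R[i]) (B : R) :
    (forall s, path_derive f s (df s)) ->
    (forall s : R, 0 <= s <= 1 -> normc (df s) <= B) ->
  normc (f 1 - f 0) <= B + B.
Proof.
move=> fdf dfB.
have MVT1 (g dg : R -> R) : (forall s : R, is_derive s 1 g (dg s)) ->
    (forall s, 0 <= s <= 1 -> `|dg s| <= B) -> `|g 1 - g 0| <= B.
  move=> gdg dgB.
  have [|s] := MVT_segment ler01 (fun x _ => gdg x).
  - by apply: derivable_within_continuous => s _; have [] := gdg s.
  - by rewrite in_itv /= subr0 mulr1 => /dgB + -> .
apply: le_trans (normc_le_ReIm _) _; apply: lerD.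
  rewrite raddfB.
  apply: (MVT1 (fun x => complex.Re (f x)) (fun x => complex.Re (df x))) => [s|s /dfB].
    by have [] := fdf s.
  by apply: le_trans; exact: normc_ge_absRe.
rewrite raddfB.
apply: (MVT1 (fun x => complex.Im (f x)) (fun x => complex.Im (df x))) => [s|s /dfB].
    by have [] := fdf s.
by apply: le_trans; exact: normc_ge_absIm.
Qed.

Lemma path_derive_eq f g s df dg : f =1 g -> df = dg ->
  path_derive f s df -> path_derive g s dg.
Proof. by move=> /funext -> ->. Qed.

Lemma path_deriveD f g s df dg : path_derive f s df -> path_derive g s dg ->
  path_derive (fun x => f x + g x) s (df + dg).
Proof.
move=> [f1 f2] [g1 g2]; split.
  rewrite raddfD (_ : (fun _ => _) =
      (fun x => complex.Re (f x)) + (fun x => complex.Re (g x))).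
    exact: is_deriveD.
  by apply/funext => x; rewrite raddfD.
rewrite raddfD (_ : (fun _ => _) =
    (fun x => complex.Im (f x)) + (fun x => complex.Im (g x))).
  exact: is_deriveD.
by apply/funext => x; rewrite raddfD.
Qed.

Lemma path_derive_cst z s : path_derive (fun=> z) s 0.
Proof. by split; exact: is_derive_cst. Qed.

Lemma path_deriveM z f s df : path_derive f s df ->
  path_derive (fun x => z * f x) s (z * df).
Proof.
case: z => a b [f1 f2]; split.
  rewrite (_ : (fun _ => _) =
      a \*: (fun x => complex.Re (f x)) - b \*: (fun x => complex.Im (f x))).
    rewrite (_ : complex.Re _ = a *: complex.Re df - b *: complex.Im df); last first.
      by case: (df) => c d.
    by apply: is_deriveB; apply: is_deriveZ.
  by apply/funext => x; rewrite !fctE /=; case: (f x) => c d.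
rewrite (_ : (fun _ => _) =
    a \*: (fun x => complex.Im (f x)) + b \*: (fun x => complex.Re (f x))).
  rewrite (_ : complex.Im _ = a *: complex.Im df + b *: complex.Re df); last first.
    by case: (df) => c d /=; rewrite addrC.
  by apply: is_deriveD; apply: is_deriveZ.
by apply/funext => x; rewrite !fctE /=; case: (f x) => c d /=; rewrite addrC.
Qed.

Lemma path_derive_sum N (f : 'I_N -> R -> R[i]) s df :
    (forall i, path_derive (f i) s (df i)) ->
  path_derive (fun x => \sum_(i < N) f i x) s (\sum_(i < N) df i).
Proof.
elim: N f df => [|N IH] f df h.
  rewrite big_ord0; apply: path_derive_eq (path_derive_cst 0 s) => // x.
  by rewrite big_ord0.
rewrite big_ord_recl.
apply: path_derive_eq (path_deriveD (h ord0) (IH _ _ (fun i => h (lift ord0 i)))) => // x.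
by rewrite big_ord_recl.
Qed.

Lemma path_derive_cexp z s :
  path_derive (fun x => cexp (x%:C * z)) s (z * cexp (s%:C * z)).
Proof.
case: z => a b.
have lin c : is_derive s 1 (fun x : R => x * c) c.
  rewrite (_ : (fun _ => _) = c \*: id); last by apply/funext => x; exact: mulrC.
  by apply: is_derive_eq; rewrite [LHS]mulr1.
have dexp := @is_derive1_comp _ _ ( *%R^~ a) _ _ _ (is_derive_expR (s * a)) (lin a).
have dcos := @is_derive1_comp _ _ ( *%R^~ b) _ _ _ (is_derive_cos (s * b)) (lin b).
have dsin := @is_derive1_comp _ _ ( *%R^~ b) _ _ _ (is_derive_sin (s * b)) (lin b).
split; rewrite /cexp /=.
  rewrite (_ : (fun _ => _) = (expR \o *%R^~ a) * (cos \o *%R^~ b)).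
    apply: is_derive_eq (is_deriveM dexp dcos) _.
    by rewrite /GRing.scale /=; rewrite !mul0r !subr0 !addr0; ring.
  by apply/funext => x /=; rewrite !mul0r !subr0 !addr0.
rewrite (_ : (fun _ => _) = (expR \o *%R^~ a) * (sin \o *%R^~ b)).
  apply: is_derive_eq (is_deriveM dexp dsin) _.
  by rewrite /GRing.scale /=; rewrite !mul0r !subr0 !addr0; ring.
by apply/funext => x /=; rewrite !mul0r !subr0 !addr0.
Qed.

Lemma path_derive_Xn n s :
  path_derive (fun x => x%:C ^+ n.+1) s (n.+1%:R * s%:C ^+ n).
Proof.
have RX x m : x%:C ^+ m = (x ^+ m)%:C :> R[i] by rewrite rmorphXn.
split.
  rewrite (_ : (fun _ => _) = id ^+ n.+1).
    apply: is_derive_eq (is_deriveX _ (is_derive_id _ _)) _.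
    rewrite RX -(rmorph_nat (real_complex R)) -rmorphM /=.
    by rewrite [LHS]mulr1.
  by apply/funext => x; rewrite RX fctE.
rewrite (_ : (fun _ => _) = cst 0).
  rewrite RX -(rmorph_nat (real_complex R)) -rmorphM /=.
  exact: is_derive_cst.
by apply/funext => x; rewrite RX.
Qed.

(** * Taylor expansion and order of vanishing at the origin *)

Section Order.
Variables (N : nat) (a : 'I_N -> R).
Implicit Types C : 'I_N -> R[i].

Lemma path_derive_exp_sum1 C w s :
  path_derive (fun x => exp_sum1 a C (x%:C * w)) s
    (w * exp_sum1 a (fun i => (a i)%:C * C i) (s%:C * w)).
Proof.
rewrite /exp_sum1 mulr_sumr; apply: path_derive_sum => i.
apply: path_derive_eq (path_deriveM (C i) (path_derive_cexp ((a i)%:C * w) s)).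
  by move=> x; congr (_ * cexp _); ring.
have -> : (a i)%:C * (s%:C * w) = s%:C * ((a i)%:C * w) by ring.
by ring.
Qed.

Lemma exp_sum1_near0 C eps : 0 < eps -> exists2 rho : R, 0 < rho &
  forall w, normc w <= rho -> normc (exp_sum1 a C w - \sum_i C i) <= eps.
Proof.
move=> eps0.
pose K := 1 + \sum_i normc (C i); pose A := 1 + \sum_i `|a i|.
have K0 : 0 < K by rewrite ltr_pwDl ?sumr_ge0 // => i _; exact: normc_ge0.
have A0 : 0 < A by rewrite ltr_pwDl ?sumr_ge0.
have [rho rho0 h] := cexp_near0 (divr_gt0 eps0 K0).
(* As [A] bounds every [|a i|], all the arguments [a i * w] stay within [rho]. *)
exists (rho / A); first by rewrite divr_gt0.
move=> w wrho; rewrite /exp_sum1 -sumrB.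
apply: le_trans (ler_normc_sum _ _ _) _.
apply: (@le_trans _ _ (\sum_i normc (C i) * (eps / K))).
  apply: ler_sum => i _; rewrite -[X in _ - X]mulr1 -mulrBr normcM.
  rewrite ler_wpM2l ?normc_ge0 // h // normcM normc_real.
  rewrite ler_pdivlMr // in wrho; apply: le_trans wrho; rewrite mulrC.
  by rewrite ler_wpM2l ?normc_ge0 // (ler1D_sum i (fun j => normr_ge0 (a j))).
rewrite -mulr_suml mulrCA ger_pMr // ler_pdivrMr // mul1r /K.
by rewrite lerDr.
Qed.

(* One more order of the Taylor expansion at [0], by the mean value inequality
   along the segment from [0] to [w]. *)
Lemma exp_sum1_primitive C (b : R[i]) (q : nat) (rho eps : R) :
    (forall w, normc w <= rho ->
      normc (exp_sum1 a (fun i => (a i)%:C * C i) w - b * w ^+ q)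
        <= eps * normc w ^+ q) ->
  forall w, normc w <= rho ->
    normc (exp_sum1 a C w - \sum_i C i - b / q.+1%:R * w ^+ q.+1)
      <= (eps + eps) * normc w ^+ q.+1.
Proof.
move=> h w wrho.
pose f (x : R) := exp_sum1 a C (x%:C * w) + (- (b / q.+1%:R * w ^+ q.+1)) * x%:C ^+ q.+1.
have -> : exp_sum1 a C w - \sum_i C i - b / q.+1%:R * w ^+ q.+1 = f 1 - f 0.
  rewrite /f !mul1r mul0r expr1n mulr1 expr0n mulr0 addr0 addrAC; congr (_ + _ - _).
  by rewrite /exp_sum1; apply: eq_bigr => i _; rewrite mulr0 cexp0 mulr1.
rewrite mulrDl; apply: path_mean_value (fun s => path_deriveD (path_derive_exp_sum1 C w s)
  (path_deriveM _ (path_derive_Xn q s))) _ => s /andP[s0 s1].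
(* The factor [q + 1] cancels: the derivative at [s] is [w] times the order [q] remainder at [s w],
   to which [h] applies. *)
have -> : forall F : R[i], w * F + - (b / q.+1%:R * w ^+ q.+1) * (q.+1%:R * s%:C ^+ q) =
    w * (F - b * (s%:C * w) ^+ q).
  move=> F; have q0 : q.+1%:R != 0 :> R[i] by rewrite pnatr_eq0.
  by rewrite exprMn exprS; field.
have sw : normc (s%:C * w) <= normc w.
  by rewrite normcM normc_real ger0_norm // ler_piMl ?normc_ge0.
rewrite normcM exprS mulrCA ler_wpM2l ?normc_ge0 //.
apply: le_trans (h _ (le_trans sw wrho)) _.
have e0 : 0 <= eps * normc w ^+ q := le_trans (normc_ge0 _) (h _ wrho).
rewrite normcM normc_real ger0_norm // exprMn mulrCA ler_piMl //.
by rewrite exprn_ile1.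
Qed.

(** The moments of [C] are the derivatives at 0. In the induction, the derivative has coefficients
    [a i * C i], whose moments are those of [C] shifted by one; integrating back doubles the error,
    hence [eps / 2]. *)
Lemma exp_sum1_order C q : (forall l, (l < q)%N -> \sum_i C i * (a i)%:C ^+ l = 0) ->
  forall eps, 0 < eps -> exists2 rho : R, 0 < rho & forall w, normc w <= rho ->
    normc (exp_sum1 a C w - (\sum_i C i * (a i)%:C ^+ q) / q`!%:R * w ^+ q)
      <= eps * normc w ^+ q.
Proof.
elim: q C => [|q IH] C C0 eps eps0.
  have [rho rho0 h] := exp_sum1_near0 C eps0; exists rho => // w /h.
  rewrite !expr0 !mulr1 fact0 invr1 mulr1.
  by under [in X in _ -> X]eq_bigr do rewrite mulr1.
have eps2 : 0 < eps / 2 by rewrite divr_gt0.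
have shift l : \sum_i (a i)%:C * C i * (a i)%:C ^+ l = \sum_i C i * (a i)%:C ^+ l.+1.
  by apply: eq_bigr => i _; rewrite exprS; ring.
have [|rho rho0 h] := IH (fun i => (a i)%:C * C i) _ _ eps2.
  by move=> l lq; rewrite shift C0.
exists rho => // w wrho; have := exp_sum1_primitive h wrho.
have := C0 0%N isT; under eq_bigr do rewrite expr0 mulr1; move=> ->.
by rewrite subr0 shift factS natrM -splitr invfM [_^-1 * _^-1]mulrC !mulrA.
Qed.

(** If the first [N] moments vanished, the invertible Vandermonde matrix of the distinct [a i] would
    annihilate [C]. So the order of vanishing at 0 is finite. *)
Lemma exp_sum1_moment_neq0 C i : injective a -> C i != 0 ->
  exists q, \sum_i C i * (a i)%:C ^+ q != 0.
Proof.
move=> a_inj Ci; apply: contrapT => h.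
have h0 q : \sum_i C i * (a i)%:C ^+ q = 0.
  by apply/eqP; apply: contrapT => /negP hq; apply: h; exists q.
pose V := Vandermonde N (\row_j (a j)%:C).
have Vu : V \in unitmx.
  rewrite unitmxE det_Vandermonde unitfE; apply/prodf_neq0 => j _.
  apply/prodf_neq0 => l jl; rewrite !mxE subr_eq0; apply: contraTneq jl.
  by move=> /complexI/a_inj ->; rewrite ltnn.
have : V *m (\col_j C j) = 0.
  apply/matrixP => l j; rewrite !mxE -[RHS](h0 l); apply: eq_bigr => p _.
  by rewrite !mxE mulrC.
move/(congr1 (mulmx (invmx V))); rewrite mulKmx // mulmx0 => /matrixP/(_ i 0).
by rewrite !mxE => /eqP; rewrite (negbTE Ci).
Qed.

End Order.
(** * Zeros of exponential sums in one variable *)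

Lemma normc_cexp_le z : normc (cexp z) <= expR (normc z).
Proof.
by rewrite normc_cexp ler_expR (le_trans (ler_norm _)) ?normc_ge_absRe.
Qed.

Lemma ler_normc_dist w z : normc w - normc (w - z) <= normc z.
Proof.
by rewrite lerBlDr addrC -[X in normc X <= _](subrK z) ler_normcD.
Qed.

Lemma normc_distC w z : normc (w - z) = normc (z - w).
Proof. by rewrite -normc_opp opprB. Qed.

(** With [u = z / (n + 1)], write [e^z] as a power of [e^u] and factor the difference of powers:
    [e^u - (1 + u)] is small relative to [|u|], and each of the [n + 1] terms of the cofactor is at
    most [e^r]. *)
Lemma cexp_pow_approx (r eps : R) : 0 < r -> 0 < eps -> exists n : nat,
  forall z, normc z <= r -> normc (cexp z - (1 + z / n.+1%:R) ^+ n.+1) <= eps.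
Proof.
move=> r0 eps0; pose E := expR r; have E0 : 0 < E := expR_gt0 r.
pose e := eps / (2 * r * E); have e0 : 0 < e by rewrite divr_gt0 // !mulr_gt0.
have [rho rho0 h0] := cexp_near0 e0.
(* The primitive estimate with [q = 0] for the single term [e^w]. *)
have h1 w : normc w <= rho -> normc (cexp w - (1 + w)) <= (e + e) * normc w.
  have := @exp_sum1_primitive 1 (fun=> 1) (fun=> 1) 1 0 rho e.
  rewrite /exp_sum1 => H wrho; have := H _ w wrho.
  rewrite !big_ord_recl !big_ord0 !addr0 !mul1r !expr1 invr1 mul1r opprD addrA.
  apply=> v /h0.
  by rewrite !big_ord_recl !big_ord0 !addr0 !mul1r !expr0 !mulr1.
(* Then [n + 1 > r / rho], so [z / (n + 1)] lies within [rho]. *)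
pose n := Num.trunc (r / rho); exists n => z zr.
have n0 : 0 < n.+1%:R :> R by rewrite ltr0n.
have nC : n.+1%:R = (n.+1%:R)%:C :> R[i] by rewrite rmorph_nat.
have nzn : normc (z / n.+1%:R) = normc z / n.+1%:R.
  by rewrite nC -fmorphV normcM normc_real ger0_norm // invr_ge0 ltW.
have zn_rho : normc (z / n.+1%:R) <= rho.
  rewrite nzn ler_pdivrMr // mulrC -ler_pdivrMr //.
  apply: le_trans (ltW (truncnS_gt _)); by rewrite ler_pM2r ?invr_gt0.
have -> : cexp z = cexp (z / n.+1%:R) ^+ n.+1.
  by rewrite -cexpMn -[(z / _) *+ _]mulr_natr divfK // pnatr_eq0.
set u := z / n.+1%:R in nzn zn_rho *; pose t := expR (normc u).
have tn : t ^+ n.+1 <= E.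
  by rewrite -expRM_natl ler_expR nzn mulrC divfK ?gt_eqF.
have t1 : 1 <= t by rewrite -expR0 ler_expR normc_ge0.
have ut : normc (1 + u) <= t.
  by apply: le_trans (ler_normcD _ _) _; rewrite normc1 expR_ge1Dx.
rewrite subrXX normcM.
have sumE : normc (\sum_(i < n.+1) cexp u ^+ (n.+1.-1 - i) * (1 + u) ^+ i) <= n.+1%:R * E.
  apply: le_trans (ler_normc_sum _ _ _) _.
  rewrite mulr_natl -[X in _ *+ X]card_ord -sumr_const.
  apply: ler_sum => i _; rewrite normcM !normcX; apply: le_trans tn.
  apply: (@le_trans _ _ (t ^+ (n - i) * t ^+ i)).
    apply: ler_pM; rewrite ?exprn_ge0 ?normc_ge0 //.
      by rewrite lerXn2r ?nnegrE ?normc_ge0 ?expR_ge0 ?normc_cexp_le.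
    by rewrite lerXn2r ?nnegrE ?normc_ge0 ?expR_ge0.
  by rewrite -exprD subnK ?ler_weXn2l // -ltnS.
apply: le_trans (ler_pM (normc_ge0 _) (normc_ge0 _) (h1 _ zn_rho) sumE) _.
rewrite nzn /e.
have -> : (eps / (2 * r * E) + eps / (2 * r * E)) * (normc z / n.+1%:R) * (n.+1%:R * E) =
   eps * (normc z / r).
  by field; rewrite !gt_eqF.
by rewrite ger_pMr // ler_pdivrMr // mul1r.
Qed.

(** * Minimum modulus and stability of zeros *)

Section Sum.
Variables (N : nat) (a : 'I_N -> R).
Implicit Types C : 'I_N -> R[i].

Lemma exp_sum1D C w z :
  exp_sum1 a C (w + z) = exp_sum1 a (fun i => C i * cexp ((a i)%:C * w)) z.
Proof. by apply: eq_bigr => i _; rewrite mulrDr cexpD mulrA. Qed.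

Lemma exp_sum1_0 C : exp_sum1 a C 0 = \sum_i C i.
Proof. by apply: eq_bigr => i _; rewrite mulr0 cexp0 mulr1. Qed.

(** A translation only changes the coefficients, so the estimate at 0 applies at every point. Pairs
    of reals are used so that the extreme value theorem applies on a box. *)
Lemma normc_exp_sum1_continuous C :
  continuous (fun v : R * R => normc (exp_sum1 a C (v.1 +i* v.2))).
Proof.
move=> [x y]; apply/cvgrPdist_le => eps eps0 /=.
have [rho rho0 h] := exp_sum1_near0 a (fun i => C i * cexp ((a i)%:C * (x +i* y))) eps0.
have rho2 : 0 < rho / 2 by rewrite divr_gt0.
apply: filterS (nbhsx_ballx (x, y) _ rho2) => -[x' y'] [] /=; rewrite /ball /= => dx dy.
have /h : normc ((x' - x) +i* (y' - y)) <= rho.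
  apply: le_trans (normc_le_ReIm _) _ => /=.
  by rewrite (splitr rho) distrC [X in _ + X]distrC lerD ?ltW.
rewrite -exp_sum1_0 -!exp_sum1D addr0.
have -> : x +i* y + ((x' - x) +i* (y' - y)) = x' +i* y'.
  by apply/eqP; rewrite eq_complex /= !subrKC !eqxx.
apply: le_trans; rewrite ler_norml lerBlDr -lerBlDl -lerBlDr.
have h1 := ler_normc_dist (exp_sum1 a C (x +i* y)) (exp_sum1 a C (x' +i* y')).
have h2 := ler_normc_dist (exp_sum1 a C (x' +i* y')) (exp_sum1 a C (x +i* y)).
by move: h1 h2; rewrite normc_distC; lra.
Qed.

(** Otherwise the modulus has a positive minimum on a square containing the disc of radius [r].
    Polynomials uniformly close to the sum then have no zero in the disc, and their minimum modulus
    principle contradicts the small value at 0. *)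
Lemma exp_sum1_zero_in_box C (r m : R) : 0 < r ->
    (forall w, normc w = r -> m <= normc (exp_sum1 a C w)) ->
    normc (\sum_i C i) < m ->
  exists w, `|complex.Re w| <= r /\ exp_sum1 a C w = 0.
Proof.
move=> r0 Fm F0; apply: contrapT => noz.
pose box : set (R * R) := [set` `[-r, r]] `*` [set` `[-r, r]].
have boxP w : `|complex.Re w| <= r -> `|complex.Im w| <= r ->
    box (complex.Re w, complex.Im w).
  by rewrite !ler_norml => ? ?; split; rewrite /= in_itv.
have [||/= [x y] /set_mem[/= xr yr] mu_min] := @compact_EVT_min _ R
    (fun v : R * R => normc (exp_sum1 a C (v.1 +i* v.2))) box _
    (compact_setX (@segment_compact R (- r) r) (@segment_compact R (- r) r)).
- by exists (0, 0); apply: (boxP 0); rewrite /= normr0 ltW.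
- by apply: continuous_subspaceT; exact: normc_exp_sum1_continuous.
set F := exp_sum1 a C in Fm noz mu_min *.
have {}mu_min w : normc w <= r -> normc (F (x +i* y)) <= normc (F w).
  move=> wr; have := mu_min (complex.Re w, complex.Im w); case: w wr => u v wr /=.
  apply; apply/mem_set/(boxP (u +i* v)) => /=.
    exact: le_trans (normc_ge_absRe _) wr.
  exact: le_trans (normc_ge_absIm _) wr.
have mu0 : 0 < normc (F (x +i* y)).
  rewrite normc_gt0; apply/eqP => Fxy; apply: noz; exists (x +i* y); split=> //=.
  by rewrite ler_norml; move: xr; rewrite in_itv.
set mu := normc (F (x +i* y)) in mu_min mu0.
(* An error [eta] keeps the polynomial nonzero where [|F| >= mu], and leaves
   [|F 0| + eta < m - eta]. *)
pose eta := Num.min mu (m - normc (F 0)) / 3.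
have F0' : 0 < m - normc (F 0) by rewrite /F exp_sum1_0 subr_gt0.
have eta0 : 0 < eta by rewrite divr_gt0 // lt_min mu0.
have eta_mu : eta <= mu / 3 by rewrite ler_pM2r ?invr_gt0 // ge_min lexx.
have eta_m : eta <= (m - normc (F 0)) / 3.
  by rewrite ler_pM2r ?invr_gt0 // ge_min lexx orbT.
pose K := 1 + \sum_i normc (C i); pose A := 1 + \sum_i `|a i|.
have K0 : 0 < K by rewrite ltr_pwDl ?sumr_ge0 // => i _; exact: normc_ge0.
have A0 : 0 < A by rewrite ltr_pwDl ?sumr_ge0.
have aA i : `|a i| <= A := ler1D_sum i (fun j => normr_ge0 (a j)).
have [n approx] := cexp_pow_approx (mulr_gt0 A0 r0) (divr_gt0 eta0 K0).
(* Each [e^(a_i w)] is replaced by [(1 + a_i w / (n + 1))^(n + 1)]. *)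
pose P : {poly R[i]} :=
  \sum_i (C i)%:P * (1 + ((a i)%:C / n.+1%:R)%:P * 'X) ^+ n.+1.
have PE w : P.[w] = \sum_i C i * (1 + (a i)%:C * w / n.+1%:R) ^+ n.+1.
  rewrite horner_sum; apply: eq_bigr => i _.
  by rewrite hornerM hornerC horner_exp hornerD hornerC hornerM hornerC hornerX mulrAC.
have FP w : normc w <= r -> normc (F w - P.[w]) <= eta.
  move=> wr; rewrite PE /F /exp_sum1 -sumrB; apply: le_trans (ler_normc_sum _ _ _) _.
  apply: (@le_trans _ _ (\sum_i normc (C i) * (eta / K))).
    apply: ler_sum => i _; rewrite -mulrBr normcM ler_wpM2l ?normc_ge0 //.
    by rewrite approx // normcM normc_real ler_pM ?normc_ge0.
  rewrite -mulr_suml mulrCA ger_pMr // ler_pdivrMr // mul1r /K.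
  by rewrite lerDr.
have : m - eta <= normc P.[0].
  apply: (@minimum_modulus_poly _ _ r) => // w wr.
    rewrite -normc_gt0; have := mu_min _ (ltW wr); have := FP _ (ltW wr).
    by have := ler_normc_dist (F w) P.[w]; lra.
  have := Fm _ wr; have := FP w; rewrite wr lexx => /(_ isT).
  by have := ler_normc_dist (F w) P.[w]; lra.
have := FP 0; rewrite normc0 => /(_ (ltW r0)); rewrite normc_distC.
by have := ler_normc_dist P.[0] (F 0); lra.
Qed.

(** A form of Hurwitz's theorem. The first nonzero moment gives a leading term [b w^q], which bounds
    the sum from below on a small circle; a small perturbation keeps this bound while the value at 0
    stays small. *)
Lemma exp_sum1_zero_perturb C i0 delta : injective a -> C i0 != 0 ->
    \sum_i C i = 0 -> 0 < delta ->
  exists2 eta, 0 < eta & forall C', (forall i, normc (C' i - C i) <= eta) ->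
    exists w, `|complex.Re w| <= delta /\ exp_sum1 a C' w = 0.
Proof.
move=> a_inj Ci0 C0 delta0.
have [q Sq minq] := ex_minnP (exp_sum1_moment_neq0 a_inj Ci0).
pose b := (\sum_i C i * (a i)%:C ^+ q) / q`!%:R.
have b0 : 0 < normc b.
  by rewrite normc_gt0 mulf_neq0 // invr_eq0 pnatr_eq0 -lt0n fact_gt0.
have lowS l : (l < q)%N -> \sum_i C i * (a i)%:C ^+ l = 0.
  by move=> lq; apply/eqP; apply: contraTT lq => /minq; rewrite -leqNgt.
have b2 : 0 < normc b / 2 by rewrite divr_gt0.
have [rho rho0 hrho] := exp_sum1_order lowS b2.
pose r := Num.min rho delta; have r0 : 0 < r by rewrite lt_min rho0.
have r_rho : r <= rho by rewrite ge_min lexx.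
have r_delta : r <= delta by rewrite ge_min lexx orbT.
pose m := normc b / 2 * r ^+ q; have m0 : 0 < m by rewrite mulr_gt0 ?exprn_gt0.
have Fm w : normc w = r -> m <= normc (exp_sum1 a C w).
  move=> wr; have := hrho w; rewrite wr => /(_ r_rho).
  have := ler_normc_dist (b * w ^+ q) (exp_sum1 a C w).
  rewrite normc_distC normcM normcX wr -/b -/m.
  have -> : normc b * r ^+ q = m + m by rewrite /m; field.
  lra.
pose A := 1 + \sum_i `|a i|.
have aA i : `|a i| <= A := ler1D_sum i (fun j => normr_ge0 (a j)).
pose E := expR (A * r); have E0 : 0 < E := expR_gt0 _.
(* [N] terms, each changed by at most [eta * E] on the disc, change the sum by at most [m / 4]. *)
pose eta := m / (4 * N.+1%:R * E).
have eta0 : 0 < eta by rewrite divr_gt0 // !mulr_gt0 // ltr0n.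
exists eta => // C' C'eta.
have FF w : normc w <= r -> normc (exp_sum1 a C' w - exp_sum1 a C w) <= m / 4.
  move=> wr; rewrite /exp_sum1 -sumrB; apply: le_trans (ler_normc_sum _ _ _) _.
  apply: (@le_trans _ _ (\sum_(i < N) eta * E)).
    apply: ler_sum => i _; rewrite -mulrBl normcM ler_pM ?normc_ge0 ?C'eta //.
    apply: le_trans (normc_cexp_le _) _; rewrite ler_expR normcM normc_real.
    by rewrite ler_pM ?normc_ge0.
  rewrite sumr_const card_ord -[_ *+ N]mulr_natl.
  have -> : N%:R * (eta * E) = m / 4 * (N%:R / N.+1%:R).
    by rewrite /eta; field; rewrite !gt_eqF //= ltr0n.
  by rewrite ger_pMr ?divr_gt0 // ler_pdivrMr ?ltr0n // mul1r ler_nat.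
(* The perturbed sum is at least [m - m / 4] on the circle and at most [m / 4] at 0. *)
have [| |w [wr Fw]] := @exp_sum1_zero_in_box C' r (m * 3 / 4) r0.
- move=> w wr; have := Fm _ wr; have := FF w; rewrite wr lexx normc_distC => /(_ isT).
  by have := ler_normc_dist (exp_sum1 a C w) (exp_sum1 a C' w); lra.
- rewrite -exp_sum1_0; have := FF 0; rewrite normc0 => /(_ (ltW r0)).
  by rewrite (exp_sum1_0 C) C0 subr0; lra.
- by exists w; split=> //; exact: le_trans wr r_delta.
Qed.

End Sum.
End Cexp.

(** * Amoebas *)

(** Take [v = (1, s, s^2, ...)]. Each [<alpha_i - alpha_j, v>] with [i != j] is a nonzero polynomial
    in [s], and the product of these polynomials cannot vanish at all natural numbers. *)
Lemma separating_direction (F : numFieldType) m N (alpha : 'I_N -> 'cV[F]_m) :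
    injective alpha ->
  exists v : 'rV[F]_m, injective (fun i => \sum_j v 0 j * alpha i j 0).
Proof.
move=> alpha_inj.
pose q (ij : 'I_N * 'I_N) := rVpoly (alpha ij.1 - alpha ij.2)^T.
pose p := \prod_(ij | ij.1 != ij.2) q ij.
have p0 : p != 0.
  apply/prodf_neq0 => -[i j] /= ij; apply: contra_neq ij => /(congr1 (@poly_rV F m)).
  rewrite rVpolyK raddf0 => /(congr1 trmx); rewrite trmxK trmx0 => /subr0_eq.
  exact: alpha_inj.
have [s ps] : exists s : F, ~~ root p s.
  apply: contrapT => h.
  have := @max_poly_roots F p [seq n%:R | n <- iota 0 (size p)] p0.
  rewrite size_map size_iota ltnn => H.
  suff : false by []; apply: H.
    by apply/allP => s _; apply: contrapT => /negP ps; apply: h; exists s.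
  by rewrite map_inj_uniq ?iota_uniq // => n n' /eqP; rewrite eqr_nat => /eqP.
exists (\row_j s ^+ j) => i j ij; apply/eqP; apply: contraNT ps => Nij.
have : root (q (i, j)) s.
  rewrite rootE (horner_coef_wide _ (size_poly _ _)).
  move: ij => /eqP; rewrite -subr_eq0 -sumrB => /eqP ij; apply/eqP; rewrite -[RHS]ij.
  by apply: eq_bigr => l _; rewrite coef_rVpoly_ord !mxE -mulrBr mulrC.
by rewrite !rootE /p horner_prod => qs; apply/prodf_eq0; exists (i, j).
Qed.

Section Assembly.
Variable R : realType.

(** Compactness of a cube in real dimension [2 N]. The free [n0] allows the index to be taken large
    as well. *)
Lemma coefficients_cluster N (C : nat -> 'I_N -> R[i]) (K : R) :
    (forall n i, normc (C n i) <= K) ->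
  exists C' : 'I_N -> R[i], forall eta n0, 0 < eta ->
    exists2 n, (n0 <= n)%N & forall i, normc (C n i - C' i) <= eta.
Proof.
move=> CK.
pose u n : 'rV[R]_(N + N) :=
  row_mx (\row_i complex.Re (C n i)) (\row_i complex.Im (C n i)).
have cK := @rV_compact R (N + N) (fun=> [set` `[- K, K]])
  (fun=> @segment_compact R (- K) K).
have [|p [_ pu]] := cK (u @ \oo) _.
  exists 0%N => // n _ i; rewrite /= in_itv /= -ler_norml.
  case: (split_ordP i) => {}i ->; rewrite ?row_mxEl ?row_mxEr mxE;
    apply: le_trans (CK n i).
    exact: normc_ge_absRe.
  exact: normc_ge_absIm.
exists (fun i => p 0 (lshift N i) +i* p 0 (rshift N i)) => eta n0 eta0.
have eta2 : 0 < eta / 2 by rewrite divr_gt0.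
have [|_ [[n n0n <-] pun]] := pu (u @` [set n | (n0 <= n)%N]) _ _ (nbhsx_ballx p _ eta2).
  by exists n0 => // n n0n; exists n.
exists n => // i; apply: le_trans (normc_le_ReIm _) _.
have [_ {}pun] := pun; have := pun 0 (rshift N i); have := pun 0 (lshift N i).
rewrite /ball /= row_mxEl row_mxEr !mxE; case: (C n i) => x y /= dx dy.
by rewrite (splitr eta) distrC [X in _ + X]distrC lerD ?ltW.
Qed.

(** * The pairing, and amoebas in coordinates *)

Section Pairing.
Variable d : nat.
Implicit Types (a : 'cV[R]_d) (z w : 'rV[R[i]]_d).

Lemma pairingD a z w : pairing a (z + w) = pairing a z + pairing a w.
Proof. by rewrite -big_split; apply: eq_bigr => j _; rewrite mxE mulrDr. Qed.

Lemma pairingZ a (s : R[i]) z : pairing a (s *: z) = s * pairing a z.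
Proof. by rewrite mulr_sumr; apply: eq_bigr => j _; rewrite mxE mulrCA. Qed.

Lemma Re_pairing a z : complex.Re (pairing a z) = \sum_j a j 0 * complex.Re (z 0 j).
Proof.
rewrite raddf_sum; apply: eq_bigr => j _; case: (z 0 j) => x y /=.
by rewrite mul0r subr0.
Qed.

Lemma pairing_real a (x : 'rV[R]_d) :
  pairing a (map_mx (real_complex R) x) = (\sum_j x 0 j * a j 0)%:C.
Proof.
by rewrite rmorph_sum; apply: eq_bigr => j _; rewrite mxE rmorphM mulrC.
Qed.

Lemma amoebaP (h : 'rV[R[i]]_d -> R[i]) (x : 'rV[R]_d) :
  amoeba h x <-> forall eps, 0 < eps -> exists2 z, h z = 0 &
    forall j, `|x 0 j - complex.Re (z 0 j)| < eps.
Proof.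
split=> [hx eps eps0|hx B /nbhs_ballP[eps /= eps0 epsB]].
  have [_ [[z hz <-] [_ xz]]] := hx _ (nbhsx_ballx x _ eps0).
  by exists z => // j; have := xz 0 j; rewrite mxE.
have [z hz xz] := hx _ eps0; exists (map_mx (@complex.Re R) z); split; first by exists z.
by apply: epsB; split=> // i j; rewrite ord1 mxE; exact: xz.
Qed.

End Pairing.

(** * The two inclusions *)

Section Deformation.
Variables (m k N : nat) (alpha : 'I_N -> 'cV[R]_m) (kappa : 'I_N -> 'cV[R]_k).
Variable c : 'I_N -> R[i].
Local Notation g := (exp_sum (lifted_support alpha kappa) c).

Lemma exp_sum_lifted z : g z = \sum_(i < N) c i *
  cexp (pairing (alpha i) (lsubmx z) + pairing (kappa i) (rsubmx z)).
Proof.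
apply: eq_bigr => i _; congr (_ * cexp _).
rewrite /pairing big_split_ord; congr (_ + _); apply: eq_bigr => j _.
  by rewrite [col _ _ _ _]mxE [lifted_support _ _ _ _]mxE col_mxEu [lsubmx _ _ _]mxE.
by rewrite [col _ _ _ _]mxE [lifted_support _ _ _ _]mxE col_mxEd [rsubmx _ _ _]mxE.
Qed.

Lemma deformationE lambda z : deformation alpha kappa c lambda z =
  g (row_mx (lsubmx z) (lambda%:C *: rsubmx z)).
Proof.
by rewrite exp_sum_lifted row_mxKl row_mxKr; under [RHS]eq_bigr do rewrite pairingZ.
Qed.

(** Zeros of the deformation near [p] have bounded real parts, so after rescaling by [l n] their
    last [k] coordinates have real parts tending to 0. *)
Lemma limit_deformation_subset p :
    limit_at0 (fun lambda => amoeba (deformation alpha kappa c lambda)) p ->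
  small_caisson (lifted_support alpha kappa) c (lsubmx p).
Proof.
move=> hp; apply/amoebaP => eps eps0.
(* One third for each step: from [p] to a limit point [p'], to some [u n], to the real part of a
   zero. *)
have eps3 : 0 < eps / 3 by rewrite divr_gt0.
have [p' [[l [u [l0 _ ul pu]]] [_ pp']]] := hp _ (nbhsx_ballx p _ eps3).
pose M := eps + \sum_j `|p 0 j|.
have M0 : 0 < M by rewrite ltr_pwDl ?sumr_ge0.
have pM j : `|p 0 j| <= M - eps.
  rewrite /M addrC addKr (bigD1 j) //= lerDl.
  by rewrite sumr_ge0.
have /cvgrPdist_lt/(_ _ (divr_gt0 eps0 M0))[n0 _ ln0] := l0.
have [|_ [[n n0n <-] [_ p'un]]] :=
    pu (u @` [set n | (n0 <= n)%N]) _ _ (nbhsx_ballx p' _ eps3).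
  by exists n0 => // n n0n; exists n.
have /amoebaP/(_ _ eps3)[z hz uz] := ul n.
have pz j : `|p 0 j - complex.Re (z 0 j)| < eps.
  have := pp' 0 j; have := p'un 0 j; have := uz j; rewrite /ball /=.
  by rewrite !ltr_norml; lra.
exists (row_mx (lsubmx z) ((l n)%:C *: rsubmx z)); first by rewrite -deformationE.
move=> j; case: (split_ordP j) => {}j ->.
  by rewrite !row_mxEl !mxE.
rewrite !row_mxEr !mxE sub0r normrN.
have -> : complex.Re ((l n)%:C * z 0 (rshift m j)) = l n * complex.Re (z 0 (rshift m j)).
  by case: (z 0 _) => x y /=; rewrite mul0r subr0.
rewrite normrM.
have zM : `|complex.Re (z 0 (rshift m j))| < M.
  have := pM (rshift m j); have := pz (rshift m j); rewrite !ltr_norml !ler_norml; lra.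
have := ln0 n n0n; rewrite /= sub0r normrN => lne.
rewrite -(divfK (lt0r_neq0 M0) eps).
by apply: ltr_pM.
Qed.

(** One [eps] controls both [lambda] and the distance, so that [eps = 1 / (j + 1)] yields the
    required sequences. *)
Lemma caisson_approx_by_deformation (x : 'rV[R]_m) (t : 'rV[R]_k) (eps : R) :
    injective alpha ->
    small_caisson (lifted_support alpha kappa) c x -> 0 < eps ->
  exists lambda : R, exists u : 'rV[R]_(m + k),
    [/\ lambda != 0, `|lambda| <= eps,
        amoeba (deformation alpha kappa c lambda) u &
        forall j, `|row_mx x t 0 j - u 0 j| <= eps].
Proof.
move=> alpha_inj xA eps0.
(* If all coefficients vanish, every point lies in every amoeba; the Hurwitz argument needs a
   nonzero one. *)
have [/forallP c0|] := boolP [forall i, c i == 0].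
  exists eps, (row_mx x t).
  split=> [|||j]; rewrite ?subrr ?normr0 ?gt_eqF ?ger0_norm ?(ltW eps0) //.
  apply: subset_closure; exists (map_mx (real_complex R) (row_mx x t)).
    by rewrite /zero_set /= /deformation big1 // => i _; rewrite (eqP (c0 i)) mul0r.
  by apply/matrixP => i j; rewrite !mxE.
rewrite negb_forall => /existsP[i0 ci0].
have {xA} xA n : exists z, exp_sum (lifted_support alpha kappa) c z = 0 /\
    forall j, `|row_mx x 0 0 j - complex.Re (z 0 j)| < n.+1%:R^-1 :> R.
  have n0 : 0 < n.+1%:R^-1 :> R by rewrite invr_gt0 ltr0n.
  by have /amoebaP/(_ _ n0)[z z0 zx] := xA; exists z.
have {xA} [z /all_and2[z0 zx]] := choice xA.
have zxl n j : `|x 0 j - complex.Re (z n 0 (lshift k j))| < n.+1%:R^-1.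
  by have := zx n (lshift k j); rewrite row_mxEl.
have zxr n j : `|complex.Re (z n 0 (rshift m j))| < n.+1%:R^-1.
  by have := zx n (rshift m j); rewrite row_mxEr mxE sub0r normrN.
have n1 n : n.+1%:R^-1 <= 1 :> R by rewrite invf_le1 ?ltr0n // ler1n.
pose C n i := c i *
  cexp (pairing (alpha i) (lsubmx (z n)) + pairing (kappa i) (rsubmx (z n))).
(* Bounds the real parts of the exponents uniformly in [n]. Hence the terms are bounded, and those
   with [c i != 0] stay away from 0. *)
pose L i := \sum_j `|alpha i j 0| * (`|x 0 j| + 1) + \sum_j `|kappa i j 0|.
have ReL n i : `|complex.Re (pairing (alpha i) (lsubmx (z n)) +
    pairing (kappa i) (rsubmx (z n)))| <= L i.
  rewrite raddfD /= !Re_pairing; apply: le_trans (ler_normD _ _) _; apply: lerD.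
    apply: le_trans (ler_norm_sum _ _ _) _; apply: ler_sum => j _.
    rewrite normrM ler_wpM2l // mxE.
    rewrite -[X in `|X|](subrK (x 0 j)) addrC; apply: le_trans (ler_normD _ _) _.
    by rewrite lerD2l distrC; exact: le_trans (ltW (zxl n j)) (n1 n).
  apply: le_trans (ler_norm_sum _ _ _) _; apply: ler_sum => j _.
  rewrite normrM ler_piMr // mxE.
  exact: le_trans (ltW (zxr n j)) (n1 n).
pose K := 1 + \sum_i normc (c i) * expR (L i).
have K0 : 0 < K.
  by rewrite ltr_pwDl ?sumr_ge0 // => i _; rewrite mulr_ge0 ?normc_ge0 ?expR_ge0.
have CK n i : normc (C n i) <= K.
  apply: (@le_trans _ _ (normc (c i) * expR (L i))).
    rewrite normcM ler_wpM2l ?normc_ge0 // normc_cexp ler_expR.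
    exact: le_trans (ler_norm _) (ReL n i).
  apply: (@ler1D_sum _ _ (fun i => normc (c i) * expR (L i))) => j.
  by rewrite mulr_ge0 ?normc_ge0 ?expR_ge0.
have C0 n : \sum_i C n i = 0 by rewrite -[RHS](z0 n) exp_sum_lifted.
have [C' CC'] := coefficients_cluster CK.
have C'0 : \sum_i C' i = 0.
  apply: contrapT => /eqP; rewrite -normc_gt0 => S0.
  have eta0 : 0 < normc (\sum_i C' i) / N.+1%:R by rewrite divr_gt0 ?ltr0n.
  have [n _ nC'] := CC' _ 0%N eta0.
  have : normc (\sum_i (C n i - C' i)) <= \sum_(i < N) normc (\sum_i C' i) / N.+1%:R.
    by apply: le_trans (ler_normc_sum _ _ _) _; apply: ler_sum.
  rewrite sumrB C0 sub0r normc_opp sumr_const card_ord -[_ *+ N]mulr_natl leNgt.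
  move=> /negP; apply; rewrite mulrCA -[ltRHS]mulr1 ltr_pM2l //.
  by rewrite ltr_pdivrMr ?ltr0n // mul1r ltr_nat.
(* The terms [C n i0] have modulus at least [b], so a cluster value has modulus at least [b / 2]. *)
have C'i0 : C' i0 != 0.
  pose b := normc (c i0) * expR (- L i0).
  have b0 : 0 < b by rewrite mulr_gt0 ?expR_gt0 ?normc_gt0.
  have b2 : 0 < b / 2 by rewrite divr_gt0.
  have [n _ nC'] := CC' _ 0%N b2.
  rewrite -normc_gt0; have := ler_normc_dist (C n i0) (C' i0); have := nC' i0.
  have : b <= normc (C n i0).
    rewrite normcM ler_wpM2l ?normc_ge0 // normc_cexp ler_expR.
    by have := ReL n i0; rewrite ler_norml => /andP[].
  lra.
have [v v_inj] := separating_direction alpha_inj.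
set a := fun i => _ in v_inj.
pose V := 1 + \sum_j `|v 0 j|.
have V0 : 0 < V by rewrite ltr_pwDl ?sumr_ge0.
have vV j : `|v 0 j| <= V := ler1D_sum j (fun j => normr_ge0 (v 0 j)).
(* Moving by [w v] with [|Re w|] at most this changes real parts by at most [eps / 2]. *)
have delta0 : 0 < eps / 2 / V by rewrite !divr_gt0.
have [eta eta0 etaP] := exp_sum1_zero_perturb v_inj C'i0 C'0 delta0.
have etaK0 : 0 < eta / 2 / K by rewrite !divr_gt0.
have [rho rho0 rhoP] := cexp_near0 etaK0.
pose T := 1 + \sum_i \sum_j `|kappa i j 0| * (`|t 0 j| + 1).
have T0i i : 0 <= \sum_j `|kappa i j 0| * (`|t 0 j| + 1).
  by rewrite sumr_ge0 // => j _; rewrite mulr_ge0 ?addr_ge0.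
have T0 : 0 < T by rewrite ltr_pwDl ?sumr_ge0.
(* The bound [rho / T] keeps every [<kappa_i, e>] within [rho]. [lambda] is fixed before [n], which
   is then taken so large that [1 / (n + 1) <= lambda / 2]. *)
pose lambda := Num.min (rho / T) eps.
have lambda0 : 0 < lambda by rewrite lt_min divr_gt0.
have lambda_rho : lambda <= rho / T by rewrite ge_min lexx.
have lambda_eps : lambda <= eps by rewrite ge_min lexx orbT.
have lambda2 : 0 < lambda / 2 by rewrite divr_gt0.
have eta2 : 0 < eta / 2 by rewrite divr_gt0.
have [n n_large nC'] := CC' _ (Num.trunc (lambda / 2)^-1) eta2.
have n_lambda : n.+1%:R^-1 <= lambda / 2.
  rewrite invf_ple ?posrE ?ltr0n //; apply: le_trans (ltW (truncnS_gt _)) _.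
  by rewrite ler_nat ltnS.
(* The real shift that gives the last [k] coordinates of [z n] the real part [lambda t] and keeps
   their imaginary part. *)
pose e : 'rV[R]_k := lambda *: t - rsubmx (map_mx (@complex.Re R) (z n)).
pose eC := map_mx (real_complex R) e.
have e_rho i : normc (pairing (kappa i) eC) <= rho.
  rewrite pairing_real normc_real; apply: le_trans (ler_norm_sum _ _ _) _.
  apply: (@le_trans _ _ (lambda * \sum_j `|kappa i j 0| * (`|t 0 j| + 1))).
    rewrite mulr_sumr; apply: ler_sum => j _; rewrite normrM mulrC mulrCA ler_wpM2l //.
    rewrite !mxE; apply: le_trans (ler_normB _ _) _.
    rewrite normrM (gtr0_norm lambda0) mulrDr mulr1 lerD2l.
    apply: le_trans (ltW (zxr n j)) _; apply: le_trans n_lambda _; lra.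
  rewrite ler_pdivlMr // in lambda_rho; apply: le_trans lambda_rho.
  by rewrite ler_wpM2l ?(ltW lambda0) // (ler1D_sum i T0i).
(* The terms of [g] after the shift: within [eta / 2] of [C n i], hence within [eta] of [C' i]. *)
pose D i := C n i * cexp (pairing (kappa i) eC).
have [i|w [wdelta Dw]] := etaP D.
  have -> : D i - C' i = C n i * (cexp (pairing (kappa i) eC) - 1) + (C n i - C' i).
    by rewrite /D; ring.
  apply: le_trans (ler_normcD _ _) _; rewrite (splitr eta) lerD //.
  rewrite normcM -[leRHS](mulfVK (lt0r_neq0 K0)) mulrC ler_pM ?normc_ge0 ?rhoP //.
pose z' : 'rV[R[i]]_m := lsubmx (z n) + w *: map_mx (real_complex R) v.
pose s' : 'rV[R[i]]_k := (lambda^-1)%:C *: (rsubmx (z n) + eC).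
exists lambda, (map_mx (@complex.Re R) (row_mx z' s')); split.
- by rewrite gt_eqF.
- by rewrite gtr0_norm.
- apply: subset_closure; exists (row_mx z' s') => //=.
  rewrite /zero_set /= deformationE row_mxKl row_mxKr exp_sum_lifted row_mxKl row_mxKr.
  rewrite /s' scalerA -rmorphM /= divff ?gt_eqF // scale1r -[RHS]Dw.
  rewrite /exp_sum1; apply: eq_bigr => i _.
  rewrite /D /C -2![RHS]mulrA -!cexpD; congr (_ * cexp _).
  by rewrite !pairingD pairingZ pairing_real /a; ring.
move=> j; case: (split_ordP j) => {}j ->;
  rewrite [map_mx _ _ _ _]mxE ?row_mxEl ?row_mxEr.
  rewrite !mxE raddfD /= opprD addrA.
  apply: le_trans (ler_normB _ _) _; rewrite (splitr eps) lerD //.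
    by apply: le_trans (ltW (zxl n j)) _; apply: le_trans n_lambda _; lra.
  have -> : complex.Re (w * (v 0 j)%:C) = complex.Re w * v 0 j.
    by case: (w) => p q /=; rewrite mulr0 subr0.
  by rewrite -[leRHS](divfK (lt0r_neq0 V0)) normrM ler_pM.
(* In these coordinates the real part is exactly [t]. *)
rewrite !mxE; case: (z n 0 _) => p q /=.
rewrite mul0r subr0 addrCA subrr addr0 mulrA mulVf ?gt_eqF // mul1r subrr normr0.
exact: ltW.
Qed.

End Deformation.
End Assembly.

(** * The limit of the amoebas *)

Theorem theorem5p1 (R : realType) (n k N : nat)
    (alpha : 'I_N -> 'cV[R]_(1 + n)) (alpha_inj : injective alpha)
    (alpha_ph : pseudo_homogeneous alpha)
    (c : 'I_N -> R[i]) (kappa : 'I_N -> 'cV[R]_k) :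
  limit_at0 (fun lambda : R => amoeba (deformation alpha kappa c lambda)) =
  [set row_mx x t | x in small_caisson (lifted_support alpha kappa) c
                  & t in [set: 'rV[R]_k]].
Proof.
apply/seteqP; split=> [p hp|_ [x xA] [t _] <-].
  exists (lsubmx p); first exact: limit_deformation_subset hp.
  by exists (rsubmx p) => //; rewrite hsubmxK.
have inv0 (j : nat) : 0 < j.+1%:R^-1 :> R by rewrite invr_gt0 ltr0n.
have [l /choice[u lu]] :=
  choice (fun j => caisson_approx_by_deformation t alpha_inj xA (inv0 j)).
have small (eps : R) : 0 < eps -> \forall j \near \oo, j.+1%:R^-1 < eps.
  move=> eps0; have /cvgrPdist_lt/(_ _ eps0) := @cvg_harmonic R.
  by apply: filterS => j; rewrite sub0r normrN ger0_norm // ltW // inv0.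
apply: subset_closure; exists l, u; split.
- apply/cvgrPdist_lt => eps /small; apply: filterS => j je.
  by rewrite sub0r normrN; have [_ lj _ _] := lu j; exact: le_lt_trans lj je.
- by move=> j; have [] := lu j.
- by move=> j; have [] := lu j.
(* The sequence [u] converges to [(x, t)], so its tails meet every neighbourhood. *)
move=> A B uA /nbhs_ballP[eps /= eps0 epsB].
have uB : (u @ \oo) B.
  have := small _ eps0; apply: filterS => j je; apply: epsB.
  split=> // i i'; rewrite ord1; have [_ _ _ uj] := lu j.
  exact: le_lt_trans (uj i') je.
exact: filter_ex (filterI uA uB).
Qed.
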